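(* There exist positive numbers $\{\kappa_\rho:\rho\in(0,1/2]\}$ such that for every $d\ge1$, every $\sigma>0$, every $\rho\in(0,1/2]$, and the non-negative orthant cone $K_+=\{\theta\in\mathbb{R}^d : \theta_j\ge0 \text{ for } j=1,\dots,d\}$, $$\inf_\psi\mathcal{E}(\psi;\{0\},K_+,\epsilon)\ \ge\ \rho\qquad\text{whenever } \epsilon>0 \text{ and } \epsilon^2\le\kappa_\rho\,\sigma^2\sqrt d,$$ where the infimum is over all measurable tests $\psi:\mathbb{R}^d\to\{0,1\}$.
   Context: Model: one observes $y=\theta+\sigma g\in\mathbb{R}^d$ with $\theta$ unknown, $g\sim N(0,I_d)$ and $\sigma>0$ known; $\mathbb{E}_\theta$ is expectation under $y\sim N(\theta,\sigma^2I_d)$. For closed convex cones $C_1\subset C_2$ and $\epsilon>0$, the uniform error of a test $\psi$ is $$\mathcal{E}(\psi;C_1,C_2,\epsilon) = \sup_{\theta\in C_1}\mathbb{E}_\theta[\psi(y)] + \sup_{\theta\in C_2\setminus B_2(C_1;\epsilon)}\mathbb{E}_\theta[1-\psi(y)],$$ where $B_2(C_1;\epsilon) = \{\theta : \min_{u\in C_1}\|\theta-u\|_2\le\epsilon\}$. *)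

(* Defs.v *)
From HB Require Import structures.
From mathcomp Require Import all_boot all_order all_algebra.
From mathcomp Require Import all_classical all_reals all_analysis.
From mathcomp Require Import measurable_realfun.
Import Order.TTheory GRing.Theory Num.Theory.
Import numFieldNormedType.Exports.

Set Implicit Arguments.
Unset Strict Implicit.
Unset Printing Implicit Defensive.

Local Open Scope classical_set_scope.
Local Open Scope ring_scope.

Section measurable_rV.
Context {R : realType} (n : nat).

Let coord : 'I_n -> 'rV[R]_n -> measurableTypeR R := fun j x => x ord0 j.

Let rV_set0 : g_sigma_preimage coord set0.
Proof. exact: sigma_algebra0. Qed.

Let rV_setC A : g_sigma_preimage coord A -> g_sigma_preimage coord (~` A).
Proof. exact: sigma_algebraC. Qed.

Let rV_bigcup (F : (set 'rV[R]_n)^nat) :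
  (forall i, g_sigma_preimage coord (F i)) ->
  g_sigma_preimage coord (\bigcup_i (F i)).
Proof. exact: sigma_algebra_bigcup. Qed.

(* The Borel sigma-algebra of R^n, as the one generated by the coordinates
   (the analogue for row vectors of the library's structure on tuples). *)
HB.instance Definition _ :=
  @isMeasurable.Build (measure_tuple_display default_measure_display)
    'rV[R]_n (g_sigma_preimage coord) rV_set0 rV_setC rV_bigcup.

End measurable_rV.

Lemma measurable_coord {R : realType} n (j : 'I_n) :
  measurable_fun [set: 'rV[R]_n] (fun x => x ord0 j : R).
Proof.
move=> _ Y mY; rewrite setTI; apply: sub_sigma_algebra => /=.
rewrite -bigcup_seq/=; exists j => /=; first by rewrite mem_index_enum.
by exists Y => //; rewrite setTI.
Qed.

Lemma measurable_fun_coordP {R : realType} d (T : measurableType d) n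
    (f : T -> 'rV[R]_n) :
  measurable_fun [set: T] f <->
  forall j, measurable_fun [set: T] (fun t => f t ord0 j : R).
Proof.
split=> [mf j|mf].
  exact: (measurableT_comp (measurable_coord j) mf).
move=> _; apply: (@measurability _ _ _ _ _ _
  (\big[setU/set0]_(i < n) preimage_set_system setT
     (fun x : 'rV[R]_n => x ord0 i : measurableTypeR R) measurable)) => //.
move=> _ [B + <-].
rewrite -bigcup_seq/= => -[j _ [A mA <-]].
rewrite !setTI.
have := mf j measurableT A mA; by rewrite setTI.
Qed.

Section gaussian.
Context {R : realType}.

Definition cons_rV n (p : measurableTypeR R * 'rV[R]_n) : 'rV[R]_n.+1 :=
  \row_j oapp (p.2 ord0) p.1 (unlift ord0 j).

Lemma measurable_cons_rV n : measurable_fun setT (@cons_rV n).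
Proof.
apply/measurable_fun_coordP => j; rewrite /cons_rV.
under eq_fun do rewrite mxE.
case: unliftP => [k|] _ /=.
  exact: (measurableT_comp (measurable_coord k) measurable_snd).
exact: measurable_fst.
Qed.

HB.instance Definition _ n :=
  isMeasurableFun.Build _ _ _ _ (@cons_rV n) (@measurable_cons_rV n).

(* N(0, I_n), as the n-fold product of the library's N(0, 1). *)
Fixpoint std_gaussian n : probability 'rV[R]_n R :=
  if n is m.+1 then
    distribution (normal_prob 0 1 \x std_gaussian m)%E (@cons_rV m)
  else dirac (0 : 'rV[R]_0).

Lemma std_gaussianE n (A : 'I_n -> set (measurableTypeR R)) :
  (forall j, measurable (A j)) ->
  std_gaussian n [set x | forall j, A j (x ord0 j)] =
  (\prod_(j < n) normal_prob 0 1 (A j))%E.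
Proof.
elim: n A => [|n IH] A mA /=.
  rewrite big_ord0 diracE mem_set//= => j; by case: j.
rewrite big_ord_recl -IH// -product_measure1E//; last first.
  rewrite [X in measurable X](_ : _ =
    \bigcap_(j in [set: 'I_n]) [set x : 'rV[R]_n | A (lift ord0 j) (x ord0 j)]).
    apply: fin_bigcap_measurable => // j _.
    rewrite -[X in measurable X]setTI.
    exact: (measurable_coord j) measurableT _ (mA _).
  by apply/seteqP; split=> x /= h j *; exact: h.
rewrite /distribution /pushforward; congr (_ _).
apply/seteqP; split=> -[x v] /=.
  move=> h; split=> [|j].
    by have := h ord0; rewrite mxE unlift_none.
  by have := h (lift ord0 j); rewrite mxE liftK.
by move=> [hx hv] j; rewrite mxE; case: unliftP => [k|] ->.
Qed.

Section observation.
Variables (d : nat) (theta : 'rV[R]_d) (sigma : R).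

Definition observation (g : 'rV[R]_d) : 'rV[R]_d := theta + sigma *: g.

Lemma measurable_observation : measurable_fun setT observation.
Proof.
apply/measurable_fun_coordP => j; rewrite /observation.
under eq_fun do rewrite !mxE.
apply: measurable_funD => //; apply: measurable_funM => //.
exact: measurable_coord.
Qed.

HB.instance Definition _ :=
  isMeasurableFun.Build _ _ _ _ observation measurable_observation.

Definition gaussian : probability 'rV[R]_d R :=
  distribution (std_gaussian d) observation.

End observation.

Definition norm2 d (x : 'rV[R]_d) : R := Num.sqrt (\sum_j x ord0 j ^+ 2).

(* The distance is written as an infimum; it is attained when C is closed and
   nonempty, the only case intended. *)
Definition cone_nbhd d (C : set 'rV[R]_d) (eps : R) : set 'rV[R]_d :=
  [set theta | inf [set norm2 (theta - u) | u in C] <= eps].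

Definition nonneg_orthant d : set 'rV[R]_d :=
  [set theta | forall j, 0 <= theta ord0 j].

(* A test returning true stands for psi(y) = 1, hence (psi y)%:R. *)
Definition uniform_error d (sigma : R) (psi : {mfun 'rV[R]_d >-> bool})
    (C1 C2 : set 'rV[R]_d) (eps : R) : \bar R :=
  let type1 theta := 'E_(gaussian theta sigma)[fun y => (psi y)%:R%R]%E in
  let type2 theta := 'E_(gaussian theta sigma)[fun y => (1 - (psi y)%:R)%R]%E in
  (ereal_sup [set type1 theta | theta in C1] +
   ereal_sup [set type2 theta | theta in C2 `\` cone_nbhd C1 eps])%E.

End gaussian.

(* Main.v *)
(* Le Cam's method with a sparse prior. For s = floor (sqrt d), split s ^ 2
   coordinates into s blocks of size s and let theta have exactly one entry
   sigma * b in each block, uniformly placed and independent across blocks.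
   Two independent copies meet in a Binomial(s, 1/s) number of blocks, so the
   mixture likelihood ratio L against N(0, sigma^2 I) satisfies
   E_0 L^2 = (1 + (expR (b ^+ 2) - 1) / s) ^+ s <= expR (expR (b ^+ 2) - 1),
   which is 2 when b ^+ 2 = ln (1 + ln 2), independently of d. The pointwise
   bound min(1, L) >= L - L^2 / 4 then makes the total error of any test at
   least 1/2, while |theta|^2 = sigma^2 b^2 s is of order sigma^2 sqrt d. *)
Require Import Defs.
From HB Require Import structures.
From mathcomp Require Import all_boot all_order all_algebra.
From mathcomp Require Import all_classical all_reals all_analysis.
From mathcomp Require Import measurable_realfun.
From mathcomp Require Import ring lra.
Import Order.TTheory GRing.Theory Num.Theory.
Import numFieldNormedType.Exports.

Set Implicit Arguments.
Unset Strict Implicit.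
Unset Printing Implicit Defensive.

Local Open Scope classical_set_scope.
Local Open Scope ring_scope.

(** * The one-dimensional normal law: density and translation *)

Lemma ge0_integral_normal_prob (R : realType) (m s : R)
    (f : measurableTypeR R -> \bar R) :
  measurable_fun setT f -> (forall x, (0 <= f x)%E) ->
  (\int[normal_prob m s]_x f x =
   \int[lebesgue_measure]_x (f x * (normal_pdf m s x)%:E))%E.
Proof.
move=> mf f0; have dom := normal_prob_dominates m s.
rewrite -(Radon_Nikodym_SigmaFinite.change_of_variables dom)//.
apply: ae_eq_integral => //.
- apply: emeasurable_funM => //.
  exact: measurable_int (Radon_Nikodym_SigmaFinite.f_integrable dom).
- apply: emeasurable_funM => //.
  by apply/measurable_EFinP; exact: measurable_normal_pdf.
(* The Radon-Nikodym derivative and [normal_pdf] have the same integral over every measurable set,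
   hence agree almost everywhere. *)
- apply: ae_eqe_mul2l; apply: integral_ae_eq => //.
  + exact: Radon_Nikodym_SigmaFinite.f_integrable.
  + by apply/measurable_EFinP; exact: measurable_normal_pdf.
  + by move=> E _ mE; rewrite -Radon_Nikodym_SigmaFinite.f_integral.
Qed.

Section translation.
Variables (R : realType) (t : R).

Let shift (x : measurableTypeR R) : measurableTypeR R := x + t.

Let measurable_shift : measurable_fun [set: measurableTypeR R] shift.
Proof. exact: measurable_funD. Qed.

HB.instance Definition _ :=
  isMeasurableFun.Build _ _ _ _ shift measurable_shift.

(** By uniqueness of Lebesgue measure it suffices to compare lengths of half-open intervals. *)
Lemma lebesgue_measure_shift (A : set (measurableTypeR R)) : measurable A ->
  pushforward lebesgue_measure shift A = lebesgue_measure A.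
Proof.
move=> mA; apply/esym/lebesgue_measure_unique => //= _ [[a b]] _ <-.
rewrite /pushforward (_ : _ @^-1` _ = `]a - t, b - t]%classic).
  rewrite !lebesgue_measure_itv/= !lte_fin ltrD2r; case: ifP => // _.
  by congr (_%:E); ring.
by apply/seteqP; split => x /=; rewrite !in_itv/= /shift ltrBlDr lerBrDr.
Qed.

Lemma ge0_integral_lebesgue_shift (f : measurableTypeR R -> \bar R) :
  measurable_fun setT f -> (forall x, (0 <= f x)%E) ->
  (\int[lebesgue_measure]_x f (x + t)%R = \int[lebesgue_measure]_x f x)%E.
Proof.
move=> mf f0.
rewrite -(ge0_integral_pushforward measurable_shift _ measurableT mf)//.
by apply: eq_measure_integral => A mA _; exact: lebesgue_measure_shift.
Qed.

End translation.

(** Translating the Lebesgue integral on the right by [t] leaves a comparison of densities: the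
    weight at [x + t] is [expR (t * x + t ^+ 2 / 2)], exactly the ratio of the normal density at [x]
    to that at [x + t]. *)
Lemma normal_prob_shift (R : realType) (t : R)
    (h : measurableTypeR R -> \bar R) :
  measurable_fun setT h -> (forall x, (0 <= h x)%E) ->
  (\int[normal_prob 0 1]_x h (t + x)%R =
   \int[normal_prob 0 1]_x (h x * (expR (t * x - t ^+ 2 / 2))%:E))%E.
Proof.
move=> mh h0.
have mg : measurable_fun setT (fun x : R => (expR (t * x - t ^+ 2 / 2))%:E).
  apply/measurable_EFinP; apply: measurableT_comp => //.
  by apply: measurable_funB => //; exact: measurable_funM.
rewrite ge0_integral_normal_prob//; last first.
  by apply: measurableT_comp => //; exact: measurable_funD.
rewrite ge0_integral_normal_prob//; first last.
- by move=> x; rewrite mule_ge0// lee_fin expR_ge0.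
- exact: emeasurable_funM.
rewrite -[RHS](@ge0_integral_lebesgue_shift _ t)//; first last.
- by move=> x; rewrite !mule_ge0// lee_fin ?expR_ge0 ?normal_pdf_ge0.
- apply: emeasurable_funM; first exact: emeasurable_funM.
  by apply/measurable_EFinP; exact: measurable_normal_pdf.
apply: eq_integral => x _; rewrite addrC -muleA; congr (_ * _)%E.
rewrite -EFinM; congr (_%:E).
rewrite !normal_pdfE ?oner_eq0// mulrCA; congr (_ * _).
rewrite /normal_fun -expRD; congr expR; by field.
Qed.

(** * Translation of the standard Gaussian on row vectors *)

Section gaussian_shift.
Context {R : realType}.

Definition dot n (u v : 'rV[R]_n) : R := \sum_j u ord0 j * v ord0 j.

Lemma measurable_dot n (t : 'rV[R]_n) : measurable_fun setT (dot t).
Proof.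
apply: measurable_sum => j; apply: measurable_funM => //.
exact: measurable_coord.
Qed.

(* The density of N(t, I_n) with respect to N(0, I_n). *)
Definition lik n (t x : 'rV[R]_n) : R := expR (dot t x - dot t t / 2).

Lemma lik_ge0 n (t x : 'rV[R]_n) : 0 <= lik t x.
Proof. exact: expR_ge0. Qed.

Lemma measurable_lik n (t : 'rV[R]_n) : measurable_fun setT (lik t).
Proof.
apply: measurableT_comp => //; apply: measurable_funB => //.
exact: measurable_dot.
Qed.

Lemma measurable_translate n (t : 'rV[R]_n) :
  measurable_fun setT (fun x : 'rV[R]_n => t + x).
Proof.
apply/measurable_fun_coordP => j; under eq_fun do rewrite mxE.
by apply: measurable_funD => //; exact: measurable_coord.
Qed.

Lemma dot_cons n (t : 'rV[R]_n.+1) x (v : 'rV[R]_n) :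
  dot t (cons_rV (x, v)) =
  t ord0 ord0 * x + dot (\row_j t ord0 (lift ord0 j)) v.
Proof.
rewrite /dot big_ord_recl /cons_rV mxE unlift_none; congr (_ + _).
by apply: eq_bigr => j _; rewrite !mxE liftK.
Qed.

Lemma cons_rV_split n (t : 'rV[R]_n.+1) :
  t = cons_rV (t ord0 ord0, \row_j t ord0 (lift ord0 j)).
Proof.
by apply/rowP => j; rewrite mxE; case: unliftP => [k|] -> //=; rewrite mxE.
Qed.

Lemma addr_cons_rV n (x y : R) (u v : 'rV[R]_n) :
  cons_rV (x, u) + cons_rV (y, v) = cons_rV (x + y, u + v).
Proof.
by apply/rowP => j; rewrite !mxE; case: unlift => [k|] //=; rewrite mxE.
Qed.

(** The density splits into the factor given by induction on the tail and the factor given by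
    [normal_prob_shift] on the first coordinate. *)
Lemma lik_cons n (t : 'rV[R]_n.+1) x (v : 'rV[R]_n) :
  lik t (cons_rV (x, v)) =
  lik (\row_j t ord0 (lift ord0 j)) v *
  expR (t ord0 ord0 * x - t ord0 ord0 ^+ 2 / 2).
Proof.
rewrite /lik -expRD; congr expR.
by rewrite dot_cons [X in _ - dot t X / _]cons_rV_split dot_cons; field.
Qed.

(* The Cameron-Martin formula. *)
Lemma std_gaussian_shift n (t : 'rV[R]_n) (h : 'rV[R]_n -> \bar R) :
  measurable_fun setT h -> (forall x, (0 <= h x)%E) ->
  (\int[std_gaussian n]_x h (t + x)%R =
   \int[std_gaussian n]_x (h x * (lik t x)%:E))%E.
Proof.
elim: n t h => [|n IH] t h mh h0 /=.
  have mlik : measurable_fun setT (fun x => (h x * (lik t x)%:E)%E).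
    by apply: emeasurable_funM => //; apply/measurable_EFinP; exact: measurable_lik.
  have mht : measurable_fun setT (fun x => h (t + x)).
    by apply: (measurableT_comp mh); exact: measurable_translate.
  rewrite !integral_dirac// !diracT !mul1e addr0.
  rewrite (_ : t = 0); last by apply/rowP => -[].
  by rewrite /lik /dot !big_ord0 mul0r subrr expR0 mule1.
set t0 := t ord0 ord0; set t' := \row_j t ord0 (lift ord0 j).
have mlik : measurable_fun setT (fun x => (h x * (lik t x)%:E)%E).
  by apply: emeasurable_funM => //; apply/measurable_EFinP; exact: measurable_lik.
have mht : measurable_fun setT (fun x => h (t + x)).
  by apply: (measurableT_comp mh); exact: measurable_translate.
rewrite !ge0_integral_distribution//; last first.
  by move=> y; rewrite mule_ge0// lee_fin lik_ge0.
have mhc : measurable_fun setT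
    (fun z : measurableTypeR R * 'rV[R]_n => h (cons_rV z)).
  exact: measurableT_comp.
have mG : measurable_fun setT (fun z : measurableTypeR R * 'rV[R]_n =>
    (h (cons_rV z) * (lik t' z.2)%:E)%E).
  apply: emeasurable_funM => //; apply/measurable_EFinP.
  by apply: (measurableT_comp (measurable_lik _)).
have G0 z : (0 <= h (cons_rV z) * (lik t' z.2)%:E)%E.
  by rewrite mule_ge0// lee_fin lik_ge0.
rewrite !fubini_tonelli1//; first last.
- by move=> z; exact: h0.
- exact: (measurableT_comp mht).
- by move=> z; rewrite /= mule_ge0// lee_fin lik_ge0.
- exact: (measurableT_comp mlik).
(* With the first coordinate frozen, the induction hypothesis absorbs the shift of the tail; what
   remains is a shift by [t0] of a function of one real variable. *)
transitivity (\int[normal_prob 0 1]_x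
    (fubini_F (std_gaussian n) (fun z => (h (cons_rV z) * (lik t' z.2)%:E)%E)
       (t0 + x)%R))%E.
  apply: eq_integral => x _; rewrite /fubini_F/=.
  rewrite -(IH t' (fun v => h (cons_rV (t0 + x, v))))//.
    by apply: eq_integral => v _; rewrite -addr_cons_rV -cons_rV_split.
  exact: (measurableT_comp mhc).
rewrite normal_prob_shift//; first last.
- by move=> x; exact: integral_ge0.
- exact: measurable_fun_fubini_tonelli_F.
apply: eq_integral => x _; rewrite /fubini_F -ge0_integralZr//=.
  by apply: eq_integral => v _; rewrite -muleA -EFinM lik_cons.
exact: (measurableT_comp mG).
Qed.

End gaussian_shift.

(** * Second moment of a mixture likelihood ratio and the resulting testing bound *)

Section mixture.
Context {R : realType} (n : nat).

Lemma integral_lik (t : 'rV[R]_n) :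
  (\int[std_gaussian n]_x (lik t x)%:E = 1)%E.
Proof.
transitivity (\int[std_gaussian n]_x (1%:E * (lik t x)%:E))%E.
  by apply: eq_integral => x _; rewrite mul1e.
rewrite -(@std_gaussian_shift _ n t (fun=> 1%:E))//.
by rewrite integral_cst// mul1e; exact: probability_setT.
Qed.

(** Read [lik t] as a change of measure: it shifts the argument of [lik s] by [t], which multiplies
    it by the constant [expR (dot s t)], and [lik s] has integral 1. *)
Lemma integral_likM (s t : 'rV[R]_n) :
  (\int[std_gaussian n]_x (lik s x * lik t x)%:E = (expR (dot s t))%:E)%E.
Proof.
under eq_integral do rewrite EFinM.
rewrite -(@std_gaussian_shift _ n t (fun x => (lik s x)%:E)); first last.
- by move=> x; rewrite lee_fin lik_ge0.
- by apply/measurable_EFinP; exact: measurable_lik.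
transitivity (\int[std_gaussian n]_x ((expR (dot s t))%:E * (lik s x)%:E))%E.
  apply: eq_integral => x _; rewrite -EFinM /lik -expRD; congr (expR _)%:E.
  rewrite addrA; congr (_ - _); rewrite /dot -big_split.
  by apply: eq_bigr => j _; rewrite mxE mulrDr.
rewrite ge0_integralZl//= ?integral_lik ?mule1//.
- by apply/measurable_EFinP; exact: measurable_lik.
- by move=> x _; rewrite lee_fin lik_ge0.
Qed.

Lemma ge0_integral_mulr_sum d (T : measurableType d)
    (mu : {measure set T -> \bar R}) (I : finType) (c : R) (f : I -> T -> R) :
  0 <= c -> (forall i, measurable_fun setT (f i)) ->
  (forall i x, 0 <= f i x) ->
  (\int[mu]_x (c * \sum_i f i x)%:E = c%:E * \sum_i \int[mu]_x (f i x)%:E)%E.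
Proof.
move=> c0 mf f0; rewrite -ge0_integral_sum//; first last.
- by move=> i x _; rewrite lee_fin.
- by move=> i; exact/measurable_EFinP.
rewrite -ge0_integralZl//=; first last.
- by move=> x _; apply: sume_ge0 => i _; rewrite lee_fin.
- by apply: emeasurable_sum => i; exact/measurable_EFinP.
by apply: eq_integral => x _; rewrite sumEFin EFinM.
Qed.

(** A bound [M] on every type II error also bounds their uniform average, which is the integral of
    [L * (1 - phi)] for the mixture ratio [L]. The sum of exponentials is the second moment of [L].
    [M] is extended real so that a supremum can take its place. *)
Lemma mixture_lower_bound (I : finType) (th : I -> 'rV[R]_n)
    (phi : 'rV[R]_n -> bool) (M : \bar R) :
  (0 < #|I|)%N -> measurable_fun setT phi ->
  (#|I|%:R^-1) ^+ 2 * \sum_i \sum_j expR (dot (th i) (th j)) <= 2 ->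
  (forall i, \int[std_gaussian n]_x (1 - (phi (th i + x)%R)%:R)%:E <= M)%E ->
  ((1 / 2)%:E <= \int[std_gaussian n]_x (phi x)%:R%:E + M)%E.
Proof.
move=> I0 mphi chi2 leM; set nu := std_gaussian n.
pose c : R := #|I|%:R^-1.
have c0 : 0 < c by rewrite invr_gt0 ltr0n.
have cI : c *+ #|I| = 1.
  by rewrite -mulr_natr mulVf// pnatr_eq0 -lt0n.
pose L x := c * \sum_i lik (th i) x.
pose B i := (\int[nu]_x (1 - (phi (th i + x)%R)%:R)%:E)%E.
have mphiR : measurable_fun setT (fun x => (phi x)%:R : R).
  have mb : measurable_fun setT (fun b : bool => b%:R : R) by [].
  exact: (measurableT_comp mb mphi).
have phi0 x : 0 <= 1 - (phi x)%:R :> R by case: (phi x); rewrite ?subrr ?subr0.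
have mlik i : measurable_fun setT (lik (th i)) by exact: measurable_lik.
have mL : measurable_fun setT L.
  by apply: measurable_funM => //; apply: measurable_sum => i.
have L0 x : 0 <= L x.
  by rewrite mulr_ge0 ?(ltW c0)// sumr_ge0// => i _; exact: lik_ge0.
have mB i : measurable_fun setT (fun x => lik (th i) x * (1 - (phi x)%:R)).
  by apply: measurable_funM => //; apply: measurable_funB.
have intL : (\int[nu]_x (L x)%:E = 1)%E.
  rewrite ge0_integral_mulr_sum// ?(ltW c0)//; last by move=> i x; exact: lik_ge0.
  under eq_bigr do rewrite integral_lik.
  by rewrite sumEFin -EFinM sumr_const mulrnAr mulr1 cI.
have intLphi : (\int[nu]_x (L x * (1 - (phi x)%:R))%:E <= M)%E.
  have -> : (\int[nu]_x (L x * (1 - (phi x)%:R))%:E =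
             c%:E * \sum_i B i)%E.
    rewrite (_ : \sum_i B i = \sum_i
        \int[nu]_x (lik (th i) x * (1 - (phi x)%:R))%:E)%E; last first.
      apply: eq_bigr => i _.
      rewrite /B (@std_gaussian_shift _ n _ (fun x => (1 - (phi x)%:R)%:E))//.
      - by apply: eq_integral => x _; rewrite -EFinM mulrC.
      - by apply/measurable_EFinP; exact: measurable_funB.
    rewrite -ge0_integral_mulr_sum// ?(ltW c0)//; last first.
      by move=> i x; rewrite mulr_ge0// lik_ge0.
    by apply: eq_integral => x _; rewrite -mulr_suml mulrA.
  (* [M] is its own average; distributivity is safe even at infinity, since [M] dominates a
     non-negative integral. *)
  have -> : M = (c%:E * \sum_(i : I) M)%E.
    have {1}-> : M = ((\sum_(i : I) c%:E) * M)%E.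
      by rewrite sumEFin sumr_const cI mul1e.
    rewrite ge0_sume_distrl; last by move=> _ _; rewrite lee_fin ltW.
    apply/esym; apply: ge0_sume_distrr.
    move=> i _; apply: le_trans (leM i); apply: integral_ge0 => x _.
    by rewrite lee_fin phi0.
  by rewrite lee_pmul2l//=; apply: lee_sum => i _; exact: leM.
have intL2 : (\int[nu]_x (L x ^+ 2 / 4)%:E <= (1 / 2)%:E)%E.
  have -> : (\int[nu]_x (L x ^+ 2 / 4)%:E = (c ^+ 2 / 4)%:E *
      \sum_(p : I * I) \int[nu]_x (lik (th p.1) x * lik (th p.2) x)%:E)%E.
    rewrite -ge0_integral_mulr_sum//; first last.
    - by move=> p x; rewrite mulr_ge0// lik_ge0.
    - by move=> p; exact: measurable_funM.
    - by rewrite mulr_ge0// exprn_ge0// ltW.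
    apply: eq_integral => x _; congr (_%:E).
    rewrite -(pair_bigA _ (fun i j => lik (th i) x * lik (th j) x))/=.
    rewrite -big_distrlr /L /= exprMn; ring.
  (* After this rewriting the pair sum is the one bounded by 2 in [chi2]; dividing by 4 leaves
     1/2. *)
  under eq_bigr do rewrite integral_likM.
  rewrite sumEFin -EFinM lee_fin.
  rewrite -(pair_bigA _ (fun i j => expR (dot (th i) (th j))))/=.
  by rewrite mulrAC ler_pdivrMr//; apply: le_trans chi2 _; lra.
have m1 : measurable_fun setT (fun x => (phi x)%:R%:E : \bar R).
  exact/measurable_EFinP.
have m2 : measurable_fun setT (fun x => (L x * (1 - (phi x)%:R))%:E).
  apply/measurable_EFinP; apply: measurable_funM => //.
  exact: measurable_funB.
have m3 : measurable_fun setT (fun x => (L x ^+ 2 / 4)%:E).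
  apply/measurable_EFinP; apply: measurable_funM => //.
  exact: measurable_funX.
(* Adding 1/2 on both sides avoids subtracting extended reals: the claim follows from integrating
   [L <= phi + L * (1 - phi) + L ^+ 2 / 4]. *)
suff : (1 <= \int[nu]_x (phi x)%:R%:E + M + (1 / 2)%:E)%E.
  move=> h; rewrite -(@leeD2rE _ (1 / 2)%:E)//.
  by rewrite -EFinD (_ : 1 / 2 + 1 / 2 = 1)//; lra.
rewrite -intL.
apply: (@le_trans _ _ (\int[nu]_x ((phi x)%:R%:E +
    (L x * (1 - (phi x)%:R))%:E + (L x ^+ 2 / 4)%:E))%E).
  apply: ge0_le_integral => //.
  - by move=> x _; rewrite lee_fin.
  - exact/measurable_EFinP.
  - by do 2 apply: emeasurable_funD => //.
  - move=> x _; rewrite -!EFinD lee_fin.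
    (* The first square settles the case where [phi x] is true, the second the case where it is
       false. *)
    have := sqr_ge0 (1 - L x / 2); have := sqr_ge0 (L x).
    by case: (phi x) => /=; nra.
rewrite ge0_integralD//=; first last.
- by move=> x _; rewrite lee_fin mulr_ge0// exprn_ge0.
- exact: emeasurable_funD.
- by move=> x _; rewrite -EFinD lee_fin addr_ge0// mulr_ge0.
rewrite ge0_integralD//=; last by move=> x _; rewrite lee_fin mulr_ge0.
by rewrite leeD// leeD.
Qed.

End mixture.

(** * The sparse prior and its chi-square bound *)

Section sparse_prior.
Context {R : realType} (s d : nat) (e : 'I_s -> 'I_s -> 'I_d) (b : R).

(** Here [e k r] is the coordinate at position [r] of block [k], and [c] selects one position per
    block. Writing the vector as a sum of indicators lets [dot] expand bilinearly. *)
Definition sparse_vec (c : {ffun 'I_s -> 'I_s}) : 'rV[R]_d :=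
  \row_j (b * (\sum_k (j == e k (c k))%:R)).

Lemma sparse_vec_ge0 c j : 0 <= b -> 0 <= sparse_vec c ord0 j.
Proof. by move=> b0; rewrite mxE mulr_ge0// sumr_ge0. Qed.

Hypothesis e_inj : forall k r l q, e k r = e l q -> k = l /\ r = q.

(** Blocks are disjoint by [e_inj], so cross terms between different blocks vanish and only
    agreements inside a block count. *)
Lemma dot_sparse_vec c c' :
  dot (sparse_vec c) (sparse_vec c') = b ^+ 2 * \sum_k (c k == c' k)%:R.
Proof.
have delta k l : \sum_j (j == e k (c k))%:R * (j == e l (c' l))%:R =
    ((k == l) && (c k == c' k))%:R :> R.
  rewrite (bigD1 (e k (c k)))//= eqxx mul1r big1 ?addr0; last first.
    by move=> j /negPf ->; rewrite mul0r.
  congr (nat_of_bool _)%:R; apply/idP/idP => [/eqP/e_inj[-> ->]|]; first by rewrite !eqxx.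
  by case/andP => /eqP -> /eqP ->.
transitivity (b ^+ 2 * \sum_k \sum_l \sum_j
    ((j == e k (c k))%:R * (j == e l (c' l))%:R : R)).
  rewrite /dot; under eq_bigr do rewrite !mxE mulrACA -expr2 big_distrlr.
  rewrite -big_distrr/=; congr (_ * _).
  by rewrite exchange_big; apply: eq_bigr => k _; rewrite exchange_big.
congr (_ * _); apply: eq_bigr => k _.
under eq_bigr do rewrite delta.
rewrite (bigD1 k)//= eqxx big1 ?addr0// => l lk.
by rewrite eq_sym (negPf lk).
Qed.

(** For fixed [c] the sum over [c'] factors over blocks: in each, one position agrees with [c] and
    contributes [expR (b ^+ 2)], the other [s - 1] contribute 1. The result does not depend on
    [c]. *)
Lemma chi2_sparse_vec : (0 < s)%N ->
  (#|{ffun 'I_s -> 'I_s}|%:R^-1) ^+ 2 *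
    \sum_c \sum_c' expR (dot (sparse_vec c) (sparse_vec c')) <=
  expR (expR (b ^+ 2) - 1).
Proof.
move=> s0; have sR : 0 < s%:R :> R by rewrite ltr0n.
have inner c : \sum_c' expR (dot (sparse_vec c) (sparse_vec c')) =
    (s%:R + (expR (b ^+ 2) - 1)) ^+ s.
  transitivity (\sum_(c' : {ffun 'I_s -> 'I_s})
      \prod_k expR (b ^+ 2 * (c k == c' k)%:R)).
    by apply: eq_bigr => c' _; rewrite dot_sparse_vec big_distrr/= expR_sum.
  rewrite -(bigA_distr_bigA (fun k r => expR (b ^+ 2 * (c k == r)%:R))).
  rewrite -[in RHS](card_ord s) -[RHS]prodr_const; apply: eq_bigr => k _.
  rewrite (bigD1 (c k))//= eqxx mulr1 (eq_bigr (fun=> 1)); last first.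
    by move=> r; rewrite eq_sym => /negPf ->; rewrite mulr0 expR0.
  rewrite sumr_const cardC1 card_ord -{2}(prednK s0) -[in RHS]natr1; ring.
under eq_bigr do rewrite inner.
rewrite sumr_const card_ffun card_ord -[X in _ * X]mulr_natl natrX.
rewrite expr2 -mulrA mulKf ?expf_neq0 ?gt_eqF//.
rewrite -exprVn -exprMn mulrDr mulVf ?gt_eqF//.
(* With both sides as [s]-th powers, the inequality [1 + x <= expR x] between the bases is
   enough. *)
have -> : expR (expR (b ^+ 2) - 1) = expR (s%:R^-1 * (expR (b ^+ 2) - 1)) ^+ s.
  by rewrite -expRM_natl mulrA mulfV ?mul1r ?gt_eqF.
have : 0 <= s%:R^-1 * (expR (b ^+ 2) - 1).
  by rewrite mulr_ge0 ?invr_ge0 ?(ltW sR)// subr_ge0 -expR0 ler_expR sqr_ge0.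
by move=> h; rewrite lerXn2r ?nnegrE ?expR_ge0 ?expR_ge1Dx ?addr_ge0.
Qed.

End sparse_prior.

(** * From the mixture bound to the uniform error, and the choice of parameters *)

Lemma uniform_error_ge (R : realType) (d : nat) (sigma eps : R)
    (psi : {mfun 'rV[R]_d >-> bool}) (I : finType) (th : I -> 'rV[R]_d) :
  (0 < #|I|)%N ->
  (#|I|%:R^-1) ^+ 2 * \sum_i \sum_j expR (dot (th i) (th j)) <= 2 ->
  (forall i, nonneg_orthant (sigma *: th i)) ->
  (forall i, eps < norm2 (sigma *: th i)) ->
  ((1 / 2)%:E <= uniform_error sigma psi [set 0%R] (@nonneg_orthant R d) eps)%E.
Proof.
move=> I0 chi2 thK theps; rewrite /uniform_error image_set1 ereal_sup1.
have mb : measurable_fun setT (fun b : bool => b%:R : R) by [].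
have mpsi : measurable_fun setT (fun y => (psi y)%:R : R).
  exact: (measurableT_comp mb).
(* The signals are [sigma *: th i], so rescaling the test by [sigma] reduces to unit noise. *)
have mphi : measurable_fun setT (fun x : 'rV[R]_d => psi (sigma *: x)).
  rewrite (_ : (fun _ => _) = psi \o observation 0 sigma).
    exact: measurableT_comp.
  by apply/funext => x /=; rewrite /observation add0r.
have -> : ('E_(gaussian 0 sigma)[fun y => (psi y)%:R] =
    \int[std_gaussian d]_x (psi (sigma *: x))%:R%:E)%E.
  rewrite unlock ge0_integral_distribution//; last exact/measurable_EFinP.
  by apply: eq_integral => x _ /=; rewrite /observation add0r.
(* The supremum of the type II errors serves as [M]. *)
apply: mixture_lower_bound I0 mphi chi2 _ => i.
apply: ereal_sup_ubound; exists (sigma *: th i).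
  split; first exact: thK.
  by rewrite /cone_nbhd/= image_set1 inf1 subr0; apply/negP; rewrite -ltNge.
rewrite unlock ge0_integral_distribution//; first last.
- by move=> x; rewrite lee_fin; case: (psi x); rewrite ?subrr ?subr0.
- by apply/measurable_EFinP; exact: measurable_funB.
by apply: eq_integral => x _ /=; rewrite /observation scalerDr.
Qed.

Theorem proposition1 (R : realType) :
  exists kappa : R -> R,
    (forall rho : R, 0 < rho <= 1 / 2 -> 0 < kappa rho) /\
    forall (d : nat) (sigma rho eps : R),
      (1 <= d)%N -> 0 < sigma -> 0 < rho <= 1 / 2 ->
      0 < eps -> eps ^+ 2 <= kappa rho * sigma ^+ 2 * Num.sqrt d%:R ->
      (rho%:E <= ereal_inf [set uniform_error sigma psi
                                  [set 0%R] (@nonneg_orthant R d) eps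
                           | psi in [set: {mfun 'rV[R]_d >-> bool}]])%E.
Proof.
pose beta : R := ln (1 + ln 2); pose b := Num.sqrt beta.
have ln2_gt0 : 0 < ln 2 :> R by rewrite ln_gt0// ltr1n.
have beta_gt0 : 0 < beta by rewrite ln_gt0// ltrDl.
have b2 : b ^+ 2 = beta by rewrite sqr_sqrtr// ltW.
(* One constant suits every [rho], because the error is shown to be at least 1/2. The halving pays
   for rounding [Num.sqrt d%:R] down to an integer. *)
exists (fun=> beta / 2); split=> [_ _|]; first by rewrite divr_gt0.
move=> d sigma rho eps d1 sigma0 /andP[_ rho2] eps0 epsle.
apply/ereal_infP => _ [psi _ <-]; apply: (@le_trans _ _ (1 / 2)%:E).
  by rewrite lee_fin.
set q := Num.sqrt d%:R in epsle.
have q1 : 1 <= q by rewrite -sqrtr1 ler_wsqrtr// ler1n.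
pose s := Num.truncn q.
have /andP[sq qs] : s%:R <= q < s.+1%:R by rewrite truncn_itv// (le_trans ler01).
have s0 : (0 < s)%N.
  by rewrite -ltnS -(ltr1n R) (le_lt_trans q1).
have s_ge1 : 1 <= s%:R :> R by rewrite ler1n.
have ssd : (s * s <= d)%N.
  rewrite -(ler_nat R) natrM -[d%:R]sqr_sqrtr// expr2.
  by rewrite ler_pM.
(* Coordinates are numbered by Euclidean division by [s], so quotient and remainder recover block
   and position; coordinates from [s * s] on carry no signal. *)
have e_lt (k r : 'I_s) : (k * s + r < d)%N.
  apply: leq_trans ssd; apply: (@leq_trans (k.+1 * s)).
    by rewrite mulSn addnC ltn_add2r.
  by rewrite leq_mul2r ltn_ord orbT.
pose e k r := Ordinal (e_lt k r).
have e_inj k r l q' : e k r = e l q' -> k = l /\ r = q'.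
  move=> /(congr1 val)/= E; split; apply: val_inj => /=.
    have := congr1 (divn^~ s) E.
    by rewrite !divnMDl// !divn_small// !addn0.
  by have := congr1 (modn^~ s) E; rewrite !modnMDl !modn_small.
apply: (@uniform_error_ge _ _ _ _ _ {ffun 'I_s -> 'I_s} (sparse_vec e b)).
- by rewrite card_ffun card_ord expn_gt0 s0.
- apply: (le_trans (chi2_sparse_vec b e_inj s0)).
  by rewrite b2 lnK ?posrE ?addr_gt0// addrAC subrr add0r lnK// posrE ltr0n.
- move=> c j; rewrite mxE mulr_ge0 ?(ltW sigma0)//.
  by rewrite sparse_vec_ge0// sqrtr_ge0.
move=> c; rewrite -[eps]gtr0_norm// -sqrtr_sqr /norm2.
(* The squared norm comes from [dot_sparse_vec] with [c' = c], where all [s] blocks agree. *)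
have -> : \sum_j (sigma *: sparse_vec e b c) ord0 j ^+ 2 =
          sigma ^+ 2 * (beta * s%:R).
  have := dot_sparse_vec b e_inj c c.
  under [X in _ * X]eq_bigr do rewrite eqxx.
  rewrite sumr_const card_ord b2 => <-; rewrite /dot big_distrr/=.
  by apply: eq_bigr => j _; rewrite mxE exprMn expr2.
rewrite ltr_sqrt; last by rewrite !mulr_gt0 ?exprn_gt0// ltr0n.
apply: (le_lt_trans epsle); rewrite mulrAC mulrC ltr_pM2l ?exprn_gt0//.
(* Strictness comes from [q < s + 1 <= 2 * s], using [1 <= s]. *)
by rewrite -mulrA ltr_pM2l//; move: qs; rewrite -natr1; lra.
Qed.
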